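(* Let $n\ge 2$. There is no constant $C$ such that $$\|u\|_{L^1(A^+_{1/2,1})}\le C\,\|u_r\|_{L^1(A^+_{1/2,1})}$$ holds for all nonnegative functions $u\in C^\infty(\overline{\mathbb{R}^n_+})$ that are superharmonic in $\mathbb{R}^n_+$ (i.e. $-\Delta u\ge0$ in $\mathbb{R}^n_+$) and vanish on $\partial\mathbb{R}^n_+$. The same is true with $\|u_r\|_{L^1(A^+_{1/2,1})}$ replaced by $\|u_r\|_{L^\infty(A^+_{1/2,1})}$: there is no constant $C$ for which the resulting inequality holds for all such $u$.
   Context: $\mathbb{R}^n_+=\{x\in\mathbb{R}^n: x_n>0\}$ and $A^+_{1/2,1}=\{x\in\mathbb{R}^n: x_n>0,\ 1/2<|x|<1\}$. The radial derivative is $u_r(x)=\frac{x}{|x|}\cdot\nabla u(x)$. *)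

(* Defs.v *)
From HB Require Import structures.
From mathcomp Require Import all_boot all_order all_algebra.
From mathcomp Require Import all_classical all_reals all_analysis.

Set Implicit Arguments.
Unset Strict Implicit.
Unset Printing Implicit Defensive.
Import Order.TTheory GRing.Theory Num.Theory.
Import numFieldNormedType.Exports.

Local Open Scope classical_set_scope.
Local Open Scope ring_scope.

Section lebesgue_tuple.
Context {R : realType}.
Local Notation T := (measurableTypeR R).

Definition cons_pair n (p : T * n.-tuple T) : n.+1.-tuple T :=
  cons_tuple p.1 p.2.

(* n-dimensional Lebesgue measure, as the n-fold product of the
   one-dimensional one. The product sigma-algebra of n.-tuple T is the Borel
   sigma-algebra of R^n. *)
Fixpoint lebesgue_tuple n : set (n.-tuple T) -> \bar R :=
  match n with
  | 0 => dirac [tuple]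
  | n'.+1 => pushforward (product_measure1 (@lebesgue_measure R)
                            (lebesgue_tuple (n := n'))) (@cons_pair n')
  end.

Definition uncons_pair n (t : n.+1.-tuple T) : T * n.-tuple T :=
  (thead t, [tuple of behead t]).

Lemma cons_pairK n : cancel (@cons_pair n) (@uncons_pair n).
Proof.
by case=> a t; rewrite /uncons_pair /= theadE; congr pair; apply/val_inj.
Qed.

Lemma measurable_cons_pair n :
  measurable_fun [set: T * n.-tuple T] (@cons_pair n).
Proof. exact: (measurable_cons measurable_fst measurable_snd). Qed.

Lemma measurable_uncons_pair n : measurable_fun setT (@uncons_pair n).
Proof.
apply/measurable_fun_pair; first exact: measurable_tnth.
exact: measurable_behead.
Qed.

Let lebesgue_tuple_bundle n :
  exists mu : {sigma_finite_measure set (n.-tuple T) -> \bar R},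
    @lebesgue_tuple n = mu.
Proof.
elim: n => [|n [mu IH]].
  by exists (dirac [tuple] : {sigma_finite_measure set (0.-tuple T) -> \bar R}).
pose p : {measure set (T * n.-tuple T)%type -> \bar R} :=
  product_measure1 (@lebesgue_measure R) mu.
pose q : {measure set (n.+1.-tuple T) -> \bar R} :=
  @measure_function_pushforward__canonical__measure_function_Measure
    _ _ _ _ _ p _ (@measurable_cons_pair n).
have qfin : sigma_finite setT q.
  have /sigma_finiteP[F [FT ndF Foo]] := sigma_finiteT (@lebesgue_measure R).
  have /sigma_finiteP[G [GT ndG Goo]] := sigma_finiteT mu.
  exists (fun k => @uncons_pair n @^-1` (F k `*` G k)).
    apply/esym/seteqP; split=> // t _.
    have [i _ Fi] : (\bigcup_i F i) (uncons_pair t).1 by rewrite -FT.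
    have [j _ Gj] : (\bigcup_j G j) (uncons_pair t).2 by rewrite -GT.
    exists (maxn i j) => //; split.
      by move: Fi; exact/subsetPset/ndF/leq_maxl.
    by move: Gj; exact/subsetPset/ndG/leq_maxr.
  move=> k; have [mF Fk] := Foo k; have [mG Gk] := Goo k; split.
    rewrite -[X in measurable X]setTI.
    by apply: measurable_uncons_pair => //; exact: measurableX.
  rewrite /q /= /pushforward -comp_preimage (_ : _ \o _ = id) ?preimage_id.
    by rewrite /p product_measure1E// lte_mul_pinfty// ge0_fin_numE.
  by apply/funext => z; exact: cons_pairK.
pose h := Measure_isSigmaFinite.Build _ _ _ q qfin.
pose Q : {sigma_finite_measure set (n.+1.-tuple T) -> \bar R} :=
  HB.pack (q : set _ -> _) (Measure.class q) h.
by exists Q; rewrite /= IH.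
Qed.

Let lebesgue_tuple0 n : @lebesgue_tuple n set0 = 0%E.
Proof. by have [mu ->] := lebesgue_tuple_bundle n; exact: measure0. Qed.

Let lebesgue_tuple_ge0 n A : (0 <= @lebesgue_tuple n A)%E.
Proof. by have [mu ->] := lebesgue_tuple_bundle n; exact: measure_ge0. Qed.

Let lebesgue_tuple_sigma_additive n : semi_sigma_additive (@lebesgue_tuple n).
Proof.
by have [mu ->] := lebesgue_tuple_bundle n; exact: measure_semi_sigma_additive.
Qed.

HB.instance Definition _ n := isMeasure.Build _ _ _ (@lebesgue_tuple n)
  (@lebesgue_tuple0 n) (@lebesgue_tuple_ge0 n)
  (@lebesgue_tuple_sigma_additive n).

Let lebesgue_tuple_sigma_finite n : sigma_finite setT (@lebesgue_tuple n).
Proof. by have [mu ->] := lebesgue_tuple_bundle n; exact: sigma_finiteT. Qed.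

HB.instance Definition _ n := Measure_isSigmaFinite.Build _ _ _
  (@lebesgue_tuple n) (@lebesgue_tuple_sigma_finite n).

End lebesgue_tuple.

Section euclidean_space.
Context {R : realType} {n : nat}.
Implicit Types (U A : set 'rV[R]_n) (u f : 'rV[R]_n -> R) (x : 'rV[R]_n).

(* The library norm `|x| on 'rV[R]_n is the sup norm; this is the Euclidean
   one. *)
Definition enorm x : R := Num.sqrt (\sum_(i < n) x ord0 i ^+ 2).

Definition rV_of_tuple (t : n.-tuple (measurableTypeR R)) : 'rV[R]_n :=
  \row_i tnth t i.

(* L^p(A) norm with respect to Lebesgue measure: the L^p(R^n) norm of f
   extended by 0 outside A. *)
Definition Lnorm_on A (p : \bar R) f : \bar R :=
  Lnorm (@lebesgue_tuple R n) p (fun t => ((f \_ A) (rV_of_tuple t))%:E).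

Definition boundary A : set 'rV[R]_n := closure A `\` interior A.

Definition partial (i : 'I_n) f : 'rV[R]_n -> R :=
  fun x => 'D_(delta_mx ord0 i) f x.

Definition iter_partial (s : seq 'I_n) f : 'rV[R]_n -> R :=
  foldr partial f s.

(* C^oo(closure U) for U open: the partial derivatives of all orders exist in
   U and extend continuously to closure U. The values of u outside closure U
   are irrelevant. *)
Definition smooth_up_to_boundary U u : Prop :=
  {within closure U, continuous u} /\
  forall s : seq 'I_n,
    (forall x (i : 'I_n), U x ->
       derivable (iter_partial s u) x (delta_mx ord0 i)) /\
    exists g : 'rV[R]_n -> R,
      {within closure U, continuous g} /\
      forall x, U x -> g x = iter_partial s u x.

Definition laplacian u x : R := \sum_(i < n) partial i (partial i u) x.

Definition superharmonic_in U u : Prop :=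
  forall x, U x -> 0 <= - laplacian u x.

Definition radial_derivative u x : R :=
  \sum_(i < n) x ord0 i / enorm x * partial i u x.

End euclidean_space.

Section half_space.
Context {R : realType} {n : nat}.

Definition half_space : set 'rV[R]_n.+1 := [set x : 'rV[R]_n.+1 | 0 < x ord0 ord_max].

Definition half_annulus : set 'rV[R]_n.+1 :=
  [set x : 'rV[R]_n.+1 | 0 < x ord0 ord_max /\ 2^-1 < enorm x < 1].

Definition admissible (u : 'rV[R]_n.+1 -> R) : Prop :=
  [/\ smooth_up_to_boundary half_space u,
      forall x, closure half_space x -> 0 <= u x,
      superharmonic_in half_space u &
      forall x, boundary half_space x -> u x = 0].

End half_space.

(* Main.v *)
From HB Require Import structures.
Require Import Defs.
From mathcomp Require Import all_boot all_order all_algebra.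
From mathcomp Require Import all_classical all_reals all_analysis.
From mathcomp Require Import measurable_realfun ess_sup_inf ring lra.
Import Order.TTheory GRing.Theory Num.Theory.
Import numFieldNormedType.Exports.
Local Open Scope classical_set_scope.
Local Open Scope ring_scope.
Set Implicit Arguments.
Unset Strict Implicit.
Unset Printing Implicit Defensive.

(** In dimension [N], the function [x_N / |x|] is nonnegative, superharmonic,
    homogeneous of degree 0 (so its radial derivative vanishes) and zero on the
    boundary; its only defect is the singularity at the origin. Replacing [|x|]
    by [rho := sqrt (|x|^2 + e)] removes it: [u := x_N / rho] is smooth,
    [- Delta u = (N - 1) x_N / rho^3 + 3 e x_N / rho^5 >= 0] and
    [u_r = e x_N / (|x| rho^3)], which is at most [8 e] on the half annulus,
    while [u >= x_N / 2] there for all [e <= 1]. Letting [e] tend to 0 excludes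
    both inequalities. *)

(** * Calculus of the regularized inverse norm and of the algebra it generates with the
    coordinates *)

Section regularized_norm.
Context {R : realType} {n : nat}.
Local Notation V := 'rV[R]_n.+1.
Variable e : R.
Hypothesis e_gt0 : 0 < e.

Definition sqnorm (x : V) : R := \sum_(i < n.+1) x ord0 i ^+ 2.
Definition coord_fun (i : 'I_n.+1) : V -> R := fun x => x ord0 i.
Definition inv_reg_norm (x : V) : R := (Num.sqrt (sqnorm x + e))^-1.

Lemma sqnorm_ge0 x : 0 <= sqnorm x.
Proof. by apply: sumr_ge0 => i _; exact: sqr_ge0. Qed.

Lemma sqnorm_add_gt0 x : 0 < sqnorm x + e.
Proof. by rewrite ltr_wpDl// sqnorm_ge0. Qed.

Lemma inv_reg_norm_gt0 x : 0 < inv_reg_norm x.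
Proof. by rewrite invr_gt0 sqrtr_gt0 sqnorm_add_gt0. Qed.

(** The algebraic relation behind the Laplacian, the radial derivative and the bounds on [u]: it
    stands in for the definition by a square root, so that [ring] and [nra] suffice. *)
Lemma inv_reg_norm_sqr x : inv_reg_norm x ^+ 2 * (sqnorm x + e) = 1.
Proof.
rewrite exprVn sqr_sqrtr ?ltW ?sqnorm_add_gt0// mulVf//.
by rewrite gt_eqF// sqnorm_add_gt0.
Qed.

(** This form lets the differentiation rules for sums and powers of functions apply. *)
Lemma sqnorm_addE : (fun x => sqnorm x + e) =
  \sum_(i < n.+1) coord_fun i ^+ 2 + cst e.
Proof. by apply/funext => x /=; rewrite !fctE fct_sumE. Qed.

Lemma differentiable_sqnorm_add x : differentiable (fun x => sqnorm x + e) x.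
Proof.
rewrite sqnorm_addE; apply: differentiableD => //.
apply: differentiable_sum => i; apply: differentiableX.
exact: differentiable_coord.
Qed.

Lemma differentiable_sqrtr (r : R) : 0 < r -> differentiable (@Num.sqrt R) r.
Proof. by move=> r0; apply/derivable1_diffP; have [] := is_derive1_sqrt r0. Qed.

Lemma differentiable_inv_reg_norm x : differentiable inv_reg_norm x.
Proof.
have s0 := sqnorm_add_gt0 x.
apply: differentiableV; last by rewrite gt_eqF// sqrtr_gt0.
exact: (differentiable_comp (differentiable_sqnorm_add x)
  (differentiable_sqrtr s0)).
Qed.

(** A coordinate is a continuous linear form, hence its own differential. *)
Lemma partial_coord_fun (i j : 'I_n.+1) x : partial i (coord_fun j) x = (i == j)%:R.
Proof.
rewrite /partial deriveE; last exact: differentiable_coord.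
have lin : linear (coord_fun j) by move=> k y z; rewrite /coord_fun !mxE.
pose f : {linear V -> R} := HB.pack (coord_fun j) (GRing.isLinear.Build _ _ _ _ _ lin).
rewrite -[coord_fun j]/(f : V -> R) diff_lin/=; last exact: coord_continuous.
by rewrite /coord_fun mxE eqxx/= eq_sym.
Qed.

Lemma partial_sqnorm_add i x : partial i (fun x => sqnorm x + e) x = 2 * x ord0 i.
Proof.
have dc j : derivable (coord_fun j ^+ 2) x (delta_mx ord0 i).
  apply: diff_derivable; apply: differentiableX; exact: differentiable_coord.
rewrite sqnorm_addE /partial deriveD//; last first.
  by apply: diff_derivable; apply: differentiable_sum => j;
     apply: differentiableX; exact: differentiable_coord.
rewrite derive_cst addr0 derive_sum// (bigD1 i)//= big1 ?addr0 => [|j ji].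
- rewrite deriveX; last by apply: diff_derivable; exact: differentiable_coord.
  by rewrite -/(partial i (coord_fun i) x) partial_coord_fun eqxx expr1 /GRing.scale/= mulr1.
- rewrite deriveX; last by apply: diff_derivable; exact: differentiable_coord.
  by rewrite -/(partial i (coord_fun j) x) partial_coord_fun eq_sym (negbTE ji) scaler0.
Qed.

Lemma partial_inv_reg_norm i : partial i inv_reg_norm = - (coord_fun i * inv_reg_norm ^+ 3).
Proof.
apply/funext => x; have s0 := sqnorm_add_gt0 x.
have ds := differentiable_sqnorm_add x.
have dq := differentiable_sqrtr s0.
rewrite /partial /inv_reg_norm deriveV; last 2 first.
- by rewrite gt_eqF// sqrtr_gt0.
- by apply: diff_derivable; exact: (differentiable_comp ds dq).
rewrite deriveE; last exact: (differentiable_comp ds dq).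
rewrite [X in _ *: X](_ : _ = (2 * x ord0 i) * (2 * Num.sqrt (sqnorm x + e))^-1).
  rewrite !fctE /coord_fun /GRing.scale /= /inv_reg_norm.
  have : Num.sqrt (sqnorm x + e) != 0 by rewrite gt_eqF// sqrtr_gt0.
  by move: (Num.sqrt _) => q q0; field.
rewrite (diff_comp ds dq)/= diff1E// derive1E derive_sqrt// -deriveE//.
by rewrite -/(partial i (fun x => sqnorm x + e) x) partial_sqnorm_add.
Qed.

(* Contains [reg_cosine] and is stable under partial derivatives, because those
   of [inv_reg_norm] are polynomials in it and the coordinates: this gives all
   orders of smoothness at once. *)
Inductive coord_alg : (V -> R) -> Prop :=
| coord_alg_cst c : coord_alg (cst c)
| coord_alg_coord i : coord_alg (coord_fun i)
| coord_alg_inv_reg_norm : coord_alg inv_reg_norm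
| coord_alg_add f h : coord_alg f -> coord_alg h -> coord_alg (f + h)
| coord_alg_mul f h : coord_alg f -> coord_alg h -> coord_alg (f * h).

Lemma coord_alg_differentiable f x : coord_alg f -> differentiable f x.
Proof.
move=> af; elim: af x => [c|i||{}f h _ IHf _ IHh|{}f h _ IHf _ IHh] x //.
- exact: differentiable_coord.
- exact: differentiable_inv_reg_norm.
- exact: differentiableD.
- exact: differentiableM.
Qed.

Lemma coord_alg_derivable f x v : coord_alg f -> derivable f x v.
Proof. by move=> af; apply/diff_derivable/coord_alg_differentiable. Qed.

Lemma coord_alg_partialD i f h : coord_alg f -> coord_alg h ->
  partial i (f + h) = partial i f + partial i h.
Proof.
by move=> af ah; apply/funext => x; rewrite /partial deriveD//; exact: coord_alg_derivable.
Qed.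

Lemma coord_alg_partialN i f : coord_alg f -> partial i (- f) = - partial i f.
Proof.
by move=> af; apply/funext => x; rewrite /partial deriveN//; exact: coord_alg_derivable.
Qed.

Lemma coord_alg_partialM i f h : coord_alg f -> coord_alg h ->
  partial i (f * h) = f * partial i h + h * partial i f.
Proof.
by move=> af ah; apply/funext => x; rewrite /partial deriveM//; exact: coord_alg_derivable.
Qed.

Lemma coord_alg_opp f : coord_alg f -> coord_alg (- f).
Proof.
move=> af; rewrite (_ : - f = cst (-1) * f); last first.
  by apply/funext => x; rewrite !fctE mulN1r.
by apply: coord_alg_mul => //; exact: coord_alg_cst.
Qed.

Lemma coord_alg_partial i f : coord_alg f -> coord_alg (partial i f).
Proof.
elim=> [c|j||{}f h af IHf ah IHh|{}f h af IHf ah IHh].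
- rewrite (_ : partial i _ = cst 0); first exact: coord_alg_cst.
  by apply/funext => x; rewrite /partial derive_cst.
- rewrite (_ : partial i _ = cst ((i == j)%:R)); first exact: coord_alg_cst.
  by apply/funext => x; rewrite partial_coord_fun.
- rewrite partial_inv_reg_norm; apply/coord_alg_opp/coord_alg_mul; first exact: coord_alg_coord.
  by rewrite !exprS expr0 mulr1; do 2?apply: coord_alg_mul; exact: coord_alg_inv_reg_norm.
- by rewrite coord_alg_partialD//; exact: coord_alg_add.
- by rewrite coord_alg_partialM//; apply: coord_alg_add; exact: coord_alg_mul.
Qed.

Lemma coord_alg_iter_partial s f : coord_alg f -> coord_alg (iter_partial s f).
Proof. by move=> af; elim: s => //= i s; exact: coord_alg_partial. Qed.

Lemma coord_alg_continuous f : coord_alg f -> continuous f.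
Proof. by move=> af x; apply/differentiable_continuous/coord_alg_differentiable. Qed.

(** Every iterated partial derivative stays in the algebra, so it is continuous on the whole space
    and serves as its own extension to the closure. *)
Lemma coord_alg_smooth U f : coord_alg f -> smooth_up_to_boundary U f.
Proof.
move=> af; split=> [|s]; first exact/continuous_subspaceT/coord_alg_continuous.
have ag := coord_alg_iter_partial s af.
split=> [x i _|]; first exact: coord_alg_derivable.
exists (iter_partial s f); split=> //.
exact/continuous_subspaceT/coord_alg_continuous.
Qed.

(** The cosine of the angle between [x] and the last axis, with [|x|] regularized. *)
Definition reg_cosine : V -> R := coord_fun ord_max * inv_reg_norm.

Lemma coord_alg_reg_cosine : coord_alg reg_cosine.
Proof. by apply: coord_alg_mul; [exact: coord_alg_coord|exact: coord_alg_inv_reg_norm]. Qed.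

Lemma partial_reg_cosine i : partial i reg_cosine =
  coord_fun ord_max * - (coord_fun i * inv_reg_norm ^+ 3)
  + inv_reg_norm * cst (i == ord_max)%:R.
Proof.
rewrite coord_alg_partialM; [|exact: coord_alg_coord|exact: coord_alg_inv_reg_norm].
rewrite partial_inv_reg_norm; congr (_ + _ * _).
by apply/funext => x; rewrite partial_coord_fun.
Qed.

End regularized_norm.

(* Unlike the library's [ge0_le_integral], needs no measurability. *)
Lemma ge0_le_integralT d (T : measurableType d) (R : realType)
    (mu : {measure set T -> \bar R}) (f g : T -> \bar R) :
  (forall x, 0 <= f x)%E -> (forall x, f x <= g x)%E ->
  (\int[mu]_x f x <= \int[mu]_x g x)%E.
Proof.
move=> f0 fg; rewrite !ge0_integralTE// => [|x]; last exact: le_trans (fg x).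
apply: le_ereal_sup => _ [h /= hf <-]; exists h => // x.
exact: le_trans (fg x).
Qed.

(** * Lebesgue measure of boxes *)

Section box.
Context {R : realType}.
Local Notation T := (measurableTypeR R).

Definition box n (F : 'I_n -> set T) : set (n.-tuple T) :=
  [set t | forall i, F i (tnth t i)].

Lemma measurable_box n (F : 'I_n -> set T) :
  (forall i, measurable (F i)) -> measurable (box F).
Proof.
move=> mF; rewrite (_ : box F = \bigcap_(i in [set: 'I_n]) (@tnth n T ^~ i) @^-1` F i).
  apply: fin_bigcap_measurable => // i _.
  by rewrite -[X in measurable X]setTI; exact: measurable_tnth.
by apply/seteqP; split=> t /= tF i => [_|]; exact: tF.
Qed.

(** Induction on the dimension: pulling a box back along [cons_pair] gives the product of its first
    side and a box of one dimension less. In dimension 0 the Dirac mass matches the empty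
    product. *)
Lemma lebesgue_tuple_box n (F : 'I_n -> set T) :
  (forall i, measurable (F i)) ->
  lebesgue_tuple (box F) = (\prod_(i < n) lebesgue_measure (F i))%E.
Proof.
elim: n F => [|n IHn] F mF.
  rewrite big_ord0 /= diracE mem_set// => -[]//.
rewrite big_ord_recl -IHn//= /pushforward.
rewrite -product_measure1E//; last exact: measurable_box.
congr (product_measure1 _ _ _); apply/seteqP; split=> -[a t] /=.
  move=> tF; split; first exact: (tF ord0).
  move=> i; have := tF (lift ord0 i); by rewrite tnthS.
move=> [Fa Ft] i; case: (unliftP ord0 i) => [j|] ->//; by rewrite tnthS; exact: Ft.
Qed.

Lemma lebesgue_tuple_box_gt0 n (F : 'I_n -> set T) :
  (forall i, measurable (F i)) -> (forall i, 0 < lebesgue_measure (F i))%E ->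
  (0 < lebesgue_tuple (box F))%E.
Proof.
move=> mF F0; rewrite lebesgue_tuple_box//.
by elim/big_ind : _ => // x y; exact: mule_gt0.
Qed.

Lemma lebesgue_tuple_box_fin n (F : 'I_n -> set T) :
  (forall i, measurable (F i)) -> (forall i, lebesgue_measure (F i) \is a fin_num) ->
  lebesgue_tuple (box F) \is a fin_num.
Proof.
move=> mF F0; rewrite lebesgue_tuple_box//.
by elim/big_ind : _ => // x y; exact: fin_numM.
Qed.

End box.

Lemma integral_cst_indic d (T : measurableType d) (R : realType)
    (mu : {measure set T -> \bar R}) (c : R) (A : set T) :
  0 <= c -> measurable A ->
  (\int[mu]_x (c * \1_A x)%:E = c%:E * mu A)%E.
Proof.
move=> c0 mA; under eq_integral do rewrite EFinM.
rewrite ge0_integralZl//=; first by rewrite integral_indic// setIT.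
exact/measurable_EFinP/measurable_indic.
Qed.

(** * The regularized cosine: admissibility and pointwise estimates *)

Section example.
Context {R : realType} {n : nat}.
Local Notation V := 'rV[R]_n.+1.
Variable e : R.
Hypothesis e_gt0 : 0 < e.
Local Notation g := (@inv_reg_norm R n e).
Local Notation u := (@reg_cosine R n e).
Implicit Types x : V.

Lemma reg_cosineE x : u x = x ord0 ord_max * g x.
Proof. by []. Qed.

Lemma partial_reg_cosineE i x :
  partial i u x = - (x ord0 ord_max * x ord0 i * g x ^+ 3)
                  + g x * (i == ord_max)%:R.
Proof. by rewrite partial_reg_cosine// !fctE /coord_fun; ring. Qed.

Lemma partial2_reg_cosineE i x : partial i (partial i u) x =
  - (x ord0 ord_max * g x ^+ 3) + 3 * x ord0 ord_max * x ord0 i ^+ 2 * g x ^+ 5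
  - 2 * x ord0 i * g x ^+ 3 * (i == ord_max)%:R.
Proof.
have ag := coord_alg_inv_reg_norm e; have ac := @coord_alg_coord R n e.
have ak := @coord_alg_cst R n e.
have acg : coord_alg e (coord_fun i * g ^+ 3).
  by rewrite !exprS expr0 mulr1; do ?apply: coord_alg_mul.
rewrite partial_reg_cosine// (coord_alg_partialD e_gt0)//;
  [|exact/coord_alg_mul/coord_alg_opp|exact: coord_alg_mul].
rewrite !(coord_alg_partialM e_gt0)//; [|exact: coord_alg_opp].
(* The cube of [g] is unfolded into products so that the Leibniz rule reaches each factor. *)
rewrite (coord_alg_partialN e_gt0)// !exprS expr0 mulr1 !(coord_alg_partialM e_gt0)//;
  try by do ?apply: coord_alg_mul.
rewrite partial_inv_reg_norm// !exprS expr0 mulr1 !fctE !partial_coord_fun (eqxx i).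
rewrite /partial derive_cst /coord_fun !expr0.
by rewrite (_ : true%:R = 1)//; move: (_ == _)%:R => d; ring.
Qed.

Lemma laplacian_reg_cosine x : laplacian u x =
  - (n%:R * x ord0 ord_max * g x ^+ 3 + 3 * e * x ord0 ord_max * g x ^+ 5).
Proof.
rewrite /laplacian; under eq_bigr do rewrite partial2_reg_cosineE.
rewrite !big_split/= sumrN sumr_const card_ord -mulr_suml -mulr_sumr -/(sqnorm x).
rewrite sumrN (bigD1 ord_max)//= big1 ?addr0 => [|i /negbTE->]; last by rewrite mulr0.
rewrite eqxx mulr1 -[_ *+ n.+1]mulr_natl -[n.+1%:R]natr1.
have := inv_reg_norm_sqr e_gt0 x.
move: (g x) (sqnorm x) (x ord0 ord_max) => G s a Gs.
(* Since [s * G ^+ 2 = 1 - e * G ^+ 2], the coefficient of [a * G ^+ 3] becomes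
   [-(n + 1) + 3 - 2 = -n], and a term in [e] remains. *)
rewrite (_ : 3 * a * s * G ^+ 5 = 3 * a * G ^+ 3 * (1 - e * G ^+ 2));
  last by rewrite -Gs; ring.
by ring.
Qed.

Lemma radial_derivative_reg_cosine x : 0 < enorm x ->
  radial_derivative u x = e * (x ord0 ord_max / enorm x) * g x ^+ 3.
Proof.
move=> x0; rewrite /radial_derivative.
under eq_bigr do rewrite partial_reg_cosineE mulrDr.
rewrite big_split/= [X in _ + X](bigD1 ord_max)//= [X in _ + (_ + X)]big1 =>
   [|i /negbTE->]; last by rewrite !mulr0.
rewrite eqxx (_ : \sum_i _ = - (x ord0 ord_max / enorm x * g x ^+ 3) * sqnorm x); last first.
  by rewrite mulr_sumr; apply: eq_bigr => i _; ring.
have := inv_reg_norm_sqr e_gt0 x.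
move: (g x) (sqnorm x) (x ord0 ord_max) => G s a Gs.
(* Inserting [1 = G ^+ 2 * (s + e)] makes the part in [s] cancel the other sum, leaving only the
   part in [e]. *)
rewrite (_ : a / enorm x * (G * 1%:R) = a / enorm x * G * (G ^+ 2 * (s + e)));
  last by rewrite Gs; ring.
by ring.
Qed.

Lemma closure_half_space_ge0 x : closure half_space x -> 0 <= x ord0 ord_max.
Proof.
have cl : closed [set y : V | 0 <= y ord0 ord_max].
  apply: (@closed_comp _ _ (fun y : V => y ord0 ord_max) [set r | 0 <= r]).
    by move=> ? _; exact: coord_continuous.
  exact: closed_ge.
move=> hx; suff : closure [set y : V | 0 <= y ord0 ord_max] x.
  by rewrite -((closure_id _).1 cl).
by move: x hx; apply: closureS => y /= /ltW.
Qed.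

(** A point of the closure has nonnegative height; positive height would make it interior, the half
    space being open. *)
Lemma boundary_half_space_eq0 x : boundary half_space x -> x ord0 ord_max = 0.
Proof.
move=> [/closure_half_space_ge0 x0 /= ix]; apply/eqP; rewrite eq_le x0 andbT leNgt.
apply/negP => xp; apply: ix.
have op : open [set y : V | 0 < y ord0 ord_max].
  apply: (@open_comp _ _ (fun y : V => y ord0 ord_max) [set r | 0 < r]).
    by move=> ? _; exact: coord_continuous.
  exact: open_gt.
by move: op; rewrite openE => /(_ x); exact.
Qed.

Lemma admissible_reg_cosine : admissible u.
Proof.
split.
- exact/coord_alg_smooth/coord_alg_reg_cosine.
- move=> x /closure_half_space_ge0 x0; rewrite reg_cosineE mulr_ge0//.
  by rewrite ltW// inv_reg_norm_gt0.
- move=> x /= x0; rewrite laplacian_reg_cosine opprK.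
  by rewrite addr_ge0// !mulr_ge0// ?exprn_ge0// ltW// inv_reg_norm_gt0.
- by move=> x /boundary_half_space_eq0 x0; rewrite reg_cosineE x0 mul0r.
Qed.

Lemma coord_le_enorm i x : `|x ord0 i| <= enorm x.
Proof.
rewrite -sqrtr_sqr ler_wsqrtr// (bigD1 i)//= lerDl.
by apply: sumr_ge0 => j _; exact: sqr_ge0.
Qed.

Lemma sqr_enorm x : enorm x ^+ 2 = sqnorm x.
Proof. by rewrite sqr_sqrtr// sqnorm_ge0. Qed.

Lemma radial_derivative_reg_cosine_le x : half_annulus x ->
  `|radial_derivative u x| <= 8 * e.
Proof.
move=> [x0 /andP[x12 _]].
have g0 := inv_reg_norm_gt0 e_gt0 x.
have en0 : 0 < enorm x by lra.
rewrite radial_derivative_reg_cosine//.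
have q0 : 0 <= x ord0 ord_max / enorm x by rewrite divr_ge0// ltW.
have q1 : x ord0 ord_max / enorm x <= 1.
  by rewrite ler_pdivrMr// mul1r (le_trans (ler_norm _))// coord_le_enorm.
have g30 : 0 <= g x ^+ 3 by rewrite exprn_ge0// ltW.
rewrite ger0_norm; last by rewrite mulr_ge0// mulr_ge0// ltW.
(* If [g > 2], then [g * |x| > 1] because [|x| > 1/2], and [g^2 * |x|^2] alone exceeds the value 1
   of [g^2 * (|x|^2 + e)]. The cube of this bound is the constant 8. *)
have g2 : g x <= 2.
  have := inv_reg_norm_sqr e_gt0 x; rewrite -sqr_enorm => gs.
  rewrite leNgt; apply/negP => g2.
  have gm : 1 < g x * enorm x by nra.
  have : 0 < g x ^+ 2 * e by rewrite mulr_gt0// exprn_gt0.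
  have : 1 < (g x * enorm x) ^+ 2 by rewrite exprn_egt1.
  by move: gs; rewrite exprMn mulrDr; lra.
have g8 : g x ^+ 3 <= 8.
  have -> : 8 = 2 ^+ 3 :> R by ring.
  by rewrite lerXn2r// nnegrE// ltW.
by rewrite -mulrA mulrC (ler_pM2r e_gt0) -[leRHS]mul1r ler_pM.
Qed.

(** Here [|x|^2 + e < 2 < 4], so [g] is at least [1/2]. *)
Lemma reg_cosine_ge x : e <= 1 -> enorm x < 1 -> 0 <= x ord0 ord_max ->
  x ord0 ord_max / 2 <= u x.
Proof.
move=> e1 x1 x0; rewrite reg_cosineE ler_wpM2l//.
have g0 := inv_reg_norm_gt0 e_gt0 x.
have := inv_reg_norm_sqr e_gt0 x; have s0 := sqnorm_ge0 x.
have : sqnorm x < 1 by rewrite -sqr_enorm expr_lt1// sqrtr_ge0.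
move: (g x) g0 (sqnorm x) s0 => G G0 s s0 s1 Gs.
rewrite leNgt; apply/negP => g2.
have G4 : G ^+ 2 < 4^-1 by nra.
by nra.
Qed.

End example.

(** * Bounds on [Lnorm_on] from pointwise bounds *)

Section Lnorm_on_bounds.
Context {R : realType} {n : nat}.
Implicit Types (A : set 'rV[R]_n) (f : 'rV[R]_n -> R)
  (B : set (n.-tuple (measurableTypeR R))).
Local Notation mu := (@lebesgue_tuple R n).

Lemma norm_patch_le A f M x : 0 <= M -> (forall x, A x -> `|f x| <= M) ->
  `|(f \_ A) x| <= M.
Proof.
move=> M0 fM; rewrite patchE; case: ifPn => [|_]; last by rewrite normr0.
by rewrite inE; exact: fM.
Qed.

(** The extension of [f] by 0 is dominated by [M] times the indicator of [B]. With [B] a box, the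
    measure of the annulus itself never has to be computed. *)
Lemma Lnorm_on1_le A f B M : 0 <= M -> measurable B ->
  (forall t, A (rV_of_tuple t) -> B t) -> (forall x, A x -> `|f x| <= M) ->
  (Lnorm_on A 1 f <= M%:E * mu B)%E.
Proof.
move=> M0 mB AB fM; rewrite /Lnorm_on Lnorm1 -integral_cst_indic//.
apply: ge0_le_integralT => t; first exact: abse_ge0.
rewrite /= lee_fin indicE; case: (boolP (t \in B)) => tB.
  by rewrite mulr1 norm_patch_le.
rewrite mulr0 patchE memNset ?normr0// => /AB.
by move/negP: tB; rewrite inE.
Qed.

Lemma Lnorm_on1_ge A f B c : 0 <= c -> measurable B ->
  (forall t, B t -> A (rV_of_tuple t)) ->
  (forall t, B t -> c <= f (rV_of_tuple t)) ->
  (c%:E * mu B <= Lnorm_on A 1 f)%E.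
Proof.
move=> c0 mB BA cf; rewrite /Lnorm_on Lnorm1 -integral_cst_indic//.
apply: ge0_le_integralT => t; first by rewrite lee_fin mulr_ge0.
rewrite /= lee_fin indicE; case: (boolP (t \in B)) => tB; last first.
  by rewrite mulr0.
rewrite inE in tB; rewrite mulr1 patchE mem_set; last exact: BA.
exact: le_trans (cf _ tB) (ler_norm _).
Qed.

Lemma Lnorm_on_infty_le A f M : 0 <= M -> (forall x, A x -> `|f x| <= M) ->
  (Lnorm_on A +oo f <= M%:E)%E.
Proof.
(* At exponent [+oo] the norm is the essential supremum if the whole space has positive measure and
   0 otherwise; the second case is settled by [0 <= M]. *)
move=> M0 fM; rewrite /Lnorm_on unlock; case: ifPn => // _.
by apply/ess_supP; apply: nearW => t /=; rewrite lee_fin norm_patch_le.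
Qed.

End Lnorm_on_bounds.

(** * A box around the half annulus and a box inside it *)

Section annulus_boxes.
Context {R : realType} {n : nat}.
Local Notation T := (measurableTypeR R).

Definition outer_side (i : 'I_n.+1) : set T := `[-1, 1]%classic.
(** The last side forces [|x| >= 3/5 > 1/2]; the others are so short that their squares add at most
    [1/4] to [(7/10)^2], which keeps [|x| < 1]. *)
Definition inner_side (i : 'I_n.+1) : set T :=
  if i == ord_max then `[3 / 5, 7 / 10]%classic
  else `[0, (2 * n.+1%:R)^-1]%classic.

Lemma outer_box_fin : lebesgue_tuple (box outer_side) \is a fin_num.
Proof.
apply: lebesgue_tuple_box_fin => i; first exact: measurable_itv.
by rewrite /outer_side lebesgue_measure_itv/=; case: ifP.
Qed.

Lemma measurable_inner_side i : measurable (inner_side i).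
Proof. by rewrite /inner_side; case: ifP => _; exact: measurable_itv. Qed.

Lemma inner_box_gt0 : (0 < lebesgue_tuple (box inner_side))%E.
Proof.
apply: lebesgue_tuple_box_gt0 => i; first exact: measurable_inner_side.
have N0 : 0 < (2 * n.+1%:R)^-1 :> R by rewrite invr_gt0 mulr_gt0.
rewrite /inner_side; case: ifP => _; rewrite lebesgue_measure_itv/= lte_fin.
  by rewrite ifT -?EFinB ?lte_fin; lra.
by rewrite N0 -EFinB lte_fin subr0.
Qed.

Lemma annulus_outer_box t : half_annulus (rV_of_tuple t) -> box outer_side t.
Proof.
move=> [_ /andP[_ /ltW t1]] i; rewrite /outer_side /= in_itv/= -ler_norml.
rewrite (le_trans _ t1)//.
by have := coord_le_enorm i (rV_of_tuple t); rewrite mxE.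
Qed.

Lemma inner_box_coord t : box inner_side t -> 3 / 5 <= (rV_of_tuple t) ord0 ord_max.
Proof.
by move=> /(_ ord_max); rewrite /inner_side eqxx/= in_itv/= mxE => /andP[].
Qed.

Lemma inner_box_annulus t : box inner_side t -> half_annulus (rV_of_tuple t).
Proof.
move=> bt; have t0 := inner_box_coord bt; split; first by lra.
apply/andP; split.
  have := coord_le_enorm ord_max (rV_of_tuple t).
  by move/(le_trans (ler_norm _)); lra.
rewrite -sqrtr1 ltr_sqrt// (bigD1 ord_max)//= .
set d : R := (2 * n.+1%:R)^-1.
have d0 : 0 < d by rewrite invr_gt0 mulr_gt0.
have dN : n.+1%:R * d = 2^-1 :> R.
  by rewrite /d invfM mulrCA divff ?mulr1.
have t1 : (rV_of_tuple t) ord0 ord_max <= 7 / 10.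
  by move: (bt ord_max); rewrite /inner_side eqxx/= in_itv/= mxE => /andP[].
(* Counting [n.+1] terms instead of [n] lets [n.+1 * d = 1/2] turn the bound into [d / 2], at most
   [1/4]. *)
have : \sum_(i < n.+1 | i != ord_max) (rV_of_tuple t) ord0 i ^+ 2 <= n.+1%:R * d ^+ 2.
  apply: (@le_trans _ _ (\sum_(i < n.+1) d ^+ 2)); last first.
    by rewrite sumr_const card_ord mulr_natl.
  rewrite [leRHS](bigD1 ord_max)//= ler_wpDl ?sqr_ge0//.
  apply: ler_sum => i im; move: (bt i); rewrite /inner_side (negbTE im)/= in_itv/= mxE.
  by move=> /andP[i0 i1]; rewrite lerXn2r// nnegrE ltW.
have d12 : d <= 2^-1.
  by rewrite lef_pV2 ?posrE ?mulr_gt0// -[leLHS]mulr1 ler_wpM2l// ler1n.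
rewrite expr2 mulrA dN; move: (\sum_(i < _ | _) _) => S HS.
by nra.
Qed.

End annulus_boxes.

(** * Contradiction for small [e], for both norms *)

Theorem mainTheorem4 (R : realType) (n : nat) (hn : (2 <= n.+1)%N) :
  (~ exists C : R, forall u : 'rV[R]_n.+1 -> R, admissible u ->
       (Lnorm_on half_annulus 1%:E u
          <= C%:E * Lnorm_on half_annulus 1%:E (radial_derivative u))%E) /\
  (~ exists C : R, forall u : 'rV[R]_n.+1 -> R, admissible u ->
       (Lnorm_on half_annulus 1%:E u
          <= C%:E * Lnorm_on half_annulus +oo%E (radial_derivative u))%E).
Proof.
pose m := lebesgue_tuple (box (@inner_side R n)).
(* A lower bound uniform in [e]: on the inner box [u >= x_N / 2 >= 3/10]. *)
have [c c0 lower] : exists2 c : R, 0 < c & forall e, 0 < e -> e <= 1 ->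
    (c%:E <= Lnorm_on half_annulus 1%:E (@reg_cosine R n e))%E.
  have m0 : (0 < m)%E by exact: inner_box_gt0.
  (* Only positivity of [m] is at hand; if [m] is [+oo], any positive real serves as [c]. *)
  have [c c0 cm] : exists2 c : R, 0 < c & (c%:E <= (3 / 10)%:E * m)%E.
    move: m m0 => [r| |]// r0; last first.
      by exists 1 => //; rewrite gt0_muley ?leey// lte_fin; lra.
    by exists (3 / 10 * r) => //; rewrite lte_fin in r0; rewrite mulr_gt0//; lra.
  exists c => // e e0 e1; apply: (le_trans cm).
  apply: Lnorm_on1_ge; [lra| |exact: inner_box_annulus|] => [|t bt].
    by apply: measurable_box => i; exact: measurable_inner_side.
  have [_ /andP[_ t1]] := inner_box_annulus bt.
  have t0 := inner_box_coord bt.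
  by apply: le_trans (reg_cosine_ge e0 e1 t1 _); lra.
(* The argument common to both norms: a bound on the norm of [u_r] that is linear in [e] beats the
   fixed lower bound [c]. *)
have no_constant (K : R) (p : \bar R) : 0 <= K ->
    (forall e : R, 0 < e ->
      (Lnorm_on half_annulus p (radial_derivative (@reg_cosine R n e))
         <= (e * K)%:E)%E) ->
    ~ exists C : R, forall u : 'rV[R]_n.+1 -> R, admissible u ->
       (Lnorm_on half_annulus 1%:E u
          <= C%:E * Lnorm_on half_annulus p (radial_derivative u))%E.
  move=> K0 upper [C HC].
  (* The summand [c] keeps [D] positive even if [C] or [K] vanishes and gives [e <= 1/2]; the factor
     2 makes [|C| * e * K] at most [c / 2]. *)
  pose D := `|C| * K + c; have D0 : 0 < D by rewrite ltr_wpDl// mulr_ge0.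
  pose e := c / (2 * D); have e0 : 0 < e by rewrite divr_gt0// mulr_gt0.
  have e1 : e <= 1.
    rewrite ler_pdivrMr ?mulr_gt0// mul1r.
    have : 0 <= `|C| * K by rewrite mulr_ge0.
    by rewrite /D; lra.
  have := le_trans (lower e e0 e1) (HC _ (admissible_reg_cosine e0)).
  apply/negP; rewrite -ltNge.
  (* [C] may be negative, so it is replaced by its absolute value before the upper bound is
     multiplied by it. *)
  apply: (@le_lt_trans _ _ (`|C|%:E * (e * K)%:E)%E).
    apply: (@le_trans _ _ (`|C|%:E *
        Lnorm_on half_annulus p (radial_derivative (@reg_cosine R n e)))%E).
      by rewrite lee_wpmul2r ?Lnorm_ge0// lee_fin ler_norm.
    by rewrite lee_wpmul2l ?lee_fin// upper.
  rewrite -EFinM lte_fin (_ : `|C| * (e * K) = c / 2 * (`|C| * K / D)); last first.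
    by rewrite /e; field; rewrite gt_eqF.
  have : `|C| * K / D <= 1 by rewrite ler_pdivrMr// mul1r lerDl ltW.
  have : 0 <= `|C| * K / D by rewrite divr_ge0 ?mulr_ge0// ltW.
  by nra.
split.
(* The pointwise bound [8 * e] is integrated over the outer cube, whose measure is finite. *)
- apply: (@no_constant (8 * fine (lebesgue_tuple (box (@outer_side R n))))) => [|e e0].
    by rewrite mulr_ge0// fine_ge0.
  rewrite mulrA (mulrC e) EFinM fineK ?outer_box_fin//.
  apply: Lnorm_on1_le => [|||x].
  + by rewrite mulr_ge0// ltW.
  + by apply: measurable_box => i; exact: measurable_itv.
  + exact: annulus_outer_box.
  + exact: radial_derivative_reg_cosine_le.
- apply: (@no_constant 8) => // e e0; rewrite mulrC.
  apply: Lnorm_on_infty_le => [|x]; [by rewrite mulr_ge0// ltW|].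
  exact: radial_derivative_reg_cosine_le.
Qed.
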